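(* Let $(X,\operatorname{d})$ be a bounded, complete metric space equipped with a convex-like structure. If $X$ has finite (Lebesgue) topological covering dimension, then $X$ is second countable.
   Context: Let $\operatorname{Prob}_n$ denote the set of probability measures on $\{1,\dots,n\}$ with the $\ell^1$-metric $\|\mu-\tilde\mu\|=\sum_i|\mu(i)-\tilde\mu(i)|$, and $X^{(n)}$ the $n$-fold Cartesian product of $X$. A bounded metric space $(X,\operatorname{d})$ has a \emph{convex-like structure} if for every $n\in\mathbb N$ and $\mu\in\operatorname{Prob}_n$ there is a continuous map $\gamma_\mu\colon X^{(n)}\to X$ such that: (1) for every permutation $\sigma\in S_n$, $\gamma_\mu(x_1,\dots,x_n)=\gamma_{\mu\circ\sigma}(x_{\sigma(1)},\dots,x_{\sigma(n)})$; (2) if $x_1=x_2$ then $\gamma_\mu(x_1,x_2,\dots,x_n)=\gamma_{\tilde\mu}(x_1,x_3,\dots,x_n)$ where $\tilde\mu(1)=\mu(1)+\mu(2)$ and $\tilde\mu(j)=\mu(j+1)$ for $2\le j\le n-1$ (in particular the unique element of $\operatorname{Prob}_1$ gives the identity map); (3) if $\mu(i)=1$ then $\gamma_\mu(x_1,\dots,x_n)=x_i$; (4) there is a constant $C$ such that $\operatorname{d}(\gamma_\mu(x_1,\dots,x_n),\gamma_{\tilde\mu}(x_1,\dots,x_n))\le C\|\mu-\tilde\mu\|$ for all $x_i$, and $\operatorname{d}(\gamma_\mu(x_1,\dots,x_n),\gamma_\mu(y_1,\dots,y_n))\le\sum_i\mu(i)\operatorname{d}(x_i,y_i)$ for all $x_i,y_i$;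 (5) for all $\nu\in\operatorname{Prob}_2$, $\mu\in\operatorname{Prob}_n$, $\tilde\mu\in\operatorname{Prob}_m$ and points $x_1,\dots,x_n,\tilde x_1,\dots,\tilde x_m$, $\gamma_\nu(\gamma_\mu(x_1,\dots,x_n),\gamma_{\tilde\mu}(\tilde x_1,\dots,\tilde x_m))=\gamma_\eta(x_1,\dots,x_n,\tilde x_1,\dots,\tilde x_m)$, where $\eta(i)=\nu(1)\mu(i)$ for $1\le i\le n$ and $\eta(n+j)=\nu(2)\tilde\mu(j)$ for $1\le j\le m$. *)

(* Defs.v *)
From Stdlib Require Import Reals.
From mathcomp Require Import all_boot.

Set Implicit Arguments.
Unset Strict Implicit.
Unset Printing Implicit Defensive.

Local Open Scope R_scope.

Definition is_metric (X : Type) (d : X -> X -> R) : Prop :=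
  (forall x y, 0 <= d x y) /\
  (forall x y, d x y = 0 <-> x = y) /\
  (forall x y, d x y = d y x) /\
  (forall x y z, d x z <= d x y + d y z).

Definition bounded_metric (X : Type) (d : X -> X -> R) : Prop :=
  exists M : R, forall x y, d x y <= M.

Definition cauchy_seq (X : Type) (d : X -> X -> R) (u : nat -> X) : Prop :=
  forall eps, 0 < eps -> exists N : nat,
    forall m n : nat, (N <= m)%nat -> (N <= n)%nat -> d (u m) (u n) < eps.

Definition converges_to (X : Type) (d : X -> X -> R) (u : nat -> X) (l : X) : Prop :=
  forall eps, 0 < eps -> exists N : nat,
    forall n : nat, (N <= n)%nat -> d (u n) l < eps.

Definition complete_metric (X : Type) (d : X -> X -> R) : Prop :=
  forall u : nat -> X, cauchy_seq d u -> exists l, converges_to d u l.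

Definition is_open (X : Type) (d : X -> X -> R) (U : X -> Prop) : Prop :=
  forall x, U x -> exists r, 0 < r /\ forall y, d x y < r -> U y.

Definition second_countable (X : Type) (d : X -> X -> R) : Prop :=
  exists B : nat -> (X -> Prop),
    (forall k, is_open d (B k)) /\
    (forall (U : X -> Prop) (x : X), is_open d U -> U x ->
       exists k, B k x /\ (forall y, B k y -> U y)).

Definition is_cover (X : Type) (k : nat) (U : 'I_k -> (X -> Prop)) : Prop :=
  forall x, exists i, U i x.

Definition covering_dim_le (X : Type) (d : X -> X -> R) (N : nat) : Prop :=
  forall (k : nat) (U : 'I_k -> (X -> Prop)),
    (forall i, is_open d (U i)) -> is_cover U ->
    exists (l : nat) (V : 'I_l -> (X -> Prop)),
      (forall j, is_open d (V j)) /\ is_cover V /\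
      (forall j, exists i, forall x, V j x -> U i x) /\
      (forall (x : X) (f : 'I_N.+2 -> 'I_l), injective f ->
         ~ (forall i, V (f i) x)).

Definition finite_covering_dim (X : Type) (d : X -> X -> R) : Prop :=
  exists N : nat, covering_dim_le d N.

Definition sumR (n : nat) (f : 'I_n -> R) : R := \big[Rplus/0]_(i < n) f i.

Definition Prob (n : nat) (mu : 'I_n -> R) : Prop :=
  (forall i, 0 <= mu i) /\ sumR mu = 1.

Definition l1dist (n : nat) (mu nu : 'I_n -> R) : R :=
  sumR (fun i => Rabs (mu i - nu i)).

Definition gamma_type (X : Type) := forall n : nat, ('I_n -> R) -> ('I_n -> X) -> X.

Definition cont_prod (X : Type) (d : X -> X -> R) (n : nat) (g : ('I_n -> X) -> X) : Prop :=
  forall (x : 'I_n -> X) eps, 0 < eps -> exists delta, 0 < delta /\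
    forall y : 'I_n -> X, (forall i, d (x i) (y i) < delta) -> d (g x) (g y) < eps.

Definition merge12 (m : nat) (mu : 'I_m.+2 -> R) : 'I_m.+1 -> R :=
  fun j => if j == ord0 then mu ord0 + mu (lift ord0 j) else mu (lift ord0 j).

Definition drop2 (X : Type) (m : nat) (x : 'I_m.+2 -> X) : 'I_m.+1 -> X :=
  fun j => if j == ord0 then x ord0 else x (lift ord0 j).

Definition catI (T : Type) (n m : nat) (a : 'I_n -> T) (b : 'I_m -> T) : 'I_(n + m) -> T :=
  fun i => match split i with inl j => a j | inr j => b j end.

Definition convex_like (X : Type) (d : X -> X -> R) (gamma : gamma_type X) : Prop :=
  (forall n (mu : 'I_n -> R), Prob mu -> cont_prod d (gamma n mu)) /\
  (forall n (mu : 'I_n -> R) (sigma : 'I_n -> 'I_n) (x : 'I_n -> X),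
     Prob mu -> bijective sigma ->
     gamma n mu x = gamma n (fun i => mu (sigma i)) (fun i => x (sigma i))) /\
  (forall m (mu : 'I_m.+2 -> R) (x : 'I_m.+2 -> X),
     Prob mu -> x ord0 = x (lift ord0 ord0) ->
     gamma m.+2 mu x = gamma m.+1 (merge12 mu) (drop2 x)) /\
  (forall n (mu : 'I_n -> R) (x : 'I_n -> X) (i : 'I_n),
     Prob mu -> mu i = 1 -> gamma n mu x = x i) /\
  (forall n : nat, exists C : R, forall (mu nu : 'I_n -> R) (x : 'I_n -> X),
     Prob mu -> Prob nu -> d (gamma n mu x) (gamma n nu x) <= C * l1dist mu nu) /\
  (forall n (mu : 'I_n -> R) (x y : 'I_n -> X),
     Prob mu -> d (gamma n mu x) (gamma n mu y) <= sumR (fun i => mu i * d (x i) (y i))) /\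
  (forall n m (nu : 'I_2 -> R) (mu : 'I_n -> R) (mu' : 'I_m -> R)
          (x : 'I_n -> X) (x' : 'I_m -> X),
     Prob nu -> Prob mu -> Prob mu' ->
     gamma 2%nat nu (fun k : 'I_2 => if k == ord0 then gamma n mu x else gamma m mu' x')
     = gamma (n + m)%nat (catI (fun i => nu ord0 * mu i) (fun j => nu ord_max * mu' j))
                     (catI x x')).

(* Main.v *)
From HB Require Import structures.
Require Import Defs.
From Stdlib Require Import Reals Lra Classical IndefiniteDescription FunctionalExtensionality.
From mathcomp Require Import all_boot all_fingroup all_algebra zify.
From Coquelicot Require Compactness.

(* If the points x_0, ..., x_n are "independent", in the sense that no point of X
   is a limit of convex combinations from every facet of the simplex they span,
   then the complements of the closed facets form an open cover of X; pulled back
   to the simplex, a Knaster-Kuratowski-Mazurkiewicz argument (Sperner's lemma)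
   shows that every finite open refinement has a point lying in n + 1 members.
   Hence covering dimension at most N excludes independent (N+2)-tuples, and there
   is a maximal independent tuple x. For every y, the dependence of (y, x) yields,
   up to arbitrarily small errors, an equation l y + (1 - l) q = p with p, q convex
   combinations of x and l bounded below. The metric satisfies the cancellation
   law d(l y + (1-l) q, l y' + (1-l) q) >= l d(y, y'), so y is determined in a
   controlled way by finitely many real parameters (l and the weights of p and q);
   discretising them covers X by countably many sets of arbitrarily small diameter. *)

Set Implicit Arguments.
Unset Strict Implicit.
Unset Printing Implicit Defensive.

(** * Sperner's lemma on a torus *)

Lemma even_card_involution (T : finType) (A : {set T}) (f : T -> T) :
  {in A, forall x, [/\ f x \in A, f x != x & f (f x) = x]} -> ~~ odd #|A|.
Proof.
have [m] := ubnP #|A|; elim: m A => // m IH A leA fA.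
have [->|[x xA]] := set_0Vmem A; first by rewrite cards0.
have [fxA fxx ffx] := fA x xA.
have fxA' : f x \in A :\ x by rewrite !inE fxx.
have cA : #|A| = (#|A :\ x :\ f x|).+2.
  by rewrite (cardsD1 x A) xA (cardsD1 (f x) (A :\ x)) fxA'.
rewrite cA /= negbK; apply: IH; first by move: leA; rewrite cA; lia.
move=> y; rewrite !inE => /and3P[yfx yx yA].
have [fyA fyy ffy] := fA y yA; split=> //.
rewrite fyA andbT; apply/andP; split; apply/eqP => e.
- by move/eqP: yx; apply; rewrite -ffy e ffx.
- by move/eqP: yfx; apply; rewrite -ffy e.
Qed.

Lemma val_add1 (M : nat) (c : 'I_M.+3) : (c + 1)%R = (if c == M.+2 :> nat then 0%N else c.+1) :> nat.
Proof.
rewrite /= (modn_small (m := 1)) // addn1.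
case: eqP => [->|ne]; first by rewrite modnn.
by rewrite modn_small //; move: (ltn_ord c); lia.
Qed.

(** * Closed walks in a finite abelian group and the parity of their rainbow cells *)

Section Walks.

Import GRing.Theory.
Local Open Scope ring_scope.

Variables (V : finZmodType) (n : nat) (s : 'I_n.+1 -> V).
Hypothesis sum_s : \sum_i s i = 0.

(** A cell is a walk that takes every step once and closes up because the steps sum to 0. Reading
    [p] cyclically allows any vertex as starting point: changing the mark only rotates [p]. *)
Definition walk (v : V) (p : 'S_n.+1) (m : nat) : V :=
  v + \sum_(0 <= i < m) s (p (inZp i)).

Definition shift_perm (j : 'I_n.+1) : 'S_n.+1 := perm (addrI j).

Lemma shift_permE j i : shift_perm j i = j + i.
Proof. by rewrite permE. Qed.

Lemma inZpD (a b : nat) : inZp (a + b) = inZp a + inZp b :> 'I_n.+1.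
Proof. by apply: val_inj; rewrite /= modnDm. Qed.

Lemma sum_nat_shift (F : nat -> V) j m :
  \sum_(j <= i < j + m) F i = \sum_(0 <= i < m) F (j + i)%N.
Proof.
rewrite -{1}[j]add0n big_addn addKn.
by apply: eq_bigr => i _; rewrite addnC.
Qed.

Lemma walk_shift v p (j : 'I_n.+1) m :
  walk (walk v p j) (shift_perm j * p)%g m = walk v p (j + m).
Proof.
rewrite /walk (big_cat_nat (n := j) (p := j + m)%N) ?leq_addr //= addrA; congr (_ + _).
rewrite (sum_nat_shift _ j).
by apply: eq_bigr => i _; rewrite permM shift_permE inZpD valZpK.
Qed.

Lemma walk_period v p m : walk v p (m + n.+1) = walk v p m.
Proof.
rewrite /walk (big_cat_nat (n := m)) ?leq_addr //= addrA -[RHS]addr0; congr (_ + _).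
rewrite (sum_nat_shift _ m) big_mkord -[RHS]sum_s.
rewrite [RHS](reindex_inj (perm_inj (s := (shift_perm (inZp m) * p)%g))) /=.
by apply: eq_bigr => i _; rewrite permM shift_permE inZpD valZpK.
Qed.

Lemma walk_mod v p m : walk v p (m %% n.+1) = walk v p m.
Proof.
rewrite {2}(divn_eq m n.+1); elim: (_ %/ _)%N => [|k IH]; first by rewrite mul0n.
by rewrite mulSn -addnA addnC walk_period.
Qed.

Lemma walk_shift_ord v p (j i : 'I_n.+1) :
  walk (walk v p j) (shift_perm j * p)%g i = walk v p (j + i : 'I_n.+1)%R.
Proof. by rewrite walk_shift -walk_mod. Qed.

Variable L : V -> 'I_n.+1.

Definition label (x : V * 'S_n.+1) (i : 'I_n.+1) := L (walk x.1 x.2 i).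

(* A pair [x = (v, p)] is a cell together with the marked vertex [v]; the door is the facet opposite to [v]. *)
Definition door x := label x @: [set~ 0] == [set~ 0].

Definition rainbow := [set x | door x && (label x 0 == 0)].

Lemma door_inj x : door x -> {in [set~ 0] &, injective (label x)}.
Proof. by move/eqP=> e; apply/imset_injP; rewrite e. Qed.

Lemma walk0 v p : walk v p 0 = v.
Proof. by rewrite /walk big_nil addr0. Qed.

Lemma rainbow_onto x c : x \in rainbow -> exists i, label x i = c.
Proof.
rewrite inE => /andP[/eqP dx /eqP l0].
have [->|c0] := eqVneq c 0; first by exists 0.
have: c \in [set~ 0] by rewrite !inE.
by rewrite -dx => /imsetP[i _ ->]; exists i.
Qed.

(** Exchanging the first and the last step moves only the marked vertex, which gives the
    neighbouring cell across the door. *)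
Definition pivot (x : V * 'S_n.+1) : V * 'S_n.+1 :=
  (x.1 + s (x.2 ord0) - s (x.2 ord_max), (tperm ord0 ord_max * x.2)%g).

Lemma pivotK : involutive pivot.
Proof.
case=> v p; rewrite /pivot /= !permM tpermL tpermR mulgA tperm2 mul1g.
by congr (_, _); rewrite subrK addrK.
Qed.

Lemma walk_pivot x (i : 'I_n.+1) : i != 0 ->
  walk (pivot x).1 (pivot x).2 i = walk x.1 x.2 i.
Proof.
case: x => v p i0; rewrite /pivot /walk /=.
have i_gt0 : (0 < i)%N by rewrite lt0n.
have i_le := ltn_ord i.
rewrite !(big_ltn i_gt0) permM.
have -> : inZp 0 = ord0 :> 'I_n.+1 by apply: val_inj.
rewrite tpermL !addrA.
rewrite subrK; congr (_ + _).
apply: eq_big_nat => k /andP[k0 ki]; rewrite permM tpermD //.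
  by apply/eqP => /(congr1 val) /=; rewrite modn_small; lia.
by apply/eqP => /(congr1 val) /=; rewrite modn_small; lia.
Qed.

Lemma door_pivot x : door (pivot x) = door x.
Proof.
rewrite /door (eq_in_imset (g := label x)) // => i.
by rewrite !inE => i0; rewrite /label walk_pivot.
Qed.

Definition twin (x : V * 'S_n.+1) : 'I_n.+1 :=
  odflt 0 [pick j | (j != 0) && (label x j == label x 0)].

Definition move_mark (x : V * 'S_n.+1) (j : 'I_n.+1) : V * 'S_n.+1 :=
  (walk x.1 x.2 j, (shift_perm j * x.2)%g).

Lemma label_move_mark x j i : label (move_mark x j) i = label x (j + i).
Proof. by rewrite /label walk_shift_ord. Qed.

Lemma twinP x : door x -> label x 0 != 0 ->
  twin x != 0 /\ label x (twin x) = label x 0.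
Proof.
move=> dx lx; rewrite /twin; case: pickP => [j /andP[j0 /eqP]|] //= no.
have: label x 0 \in [set~ 0] by rewrite !inE.
rewrite -(eqP dx) => /imsetP[j]; rewrite !inE => j0 e.
by have := no j; rewrite j0 e eqxx.
Qed.

(* [pivot] is a fixed-point free involution of the doors; on the doors whose mark
   does not have label [0], so is moving the mark to the vertex with the same label. *)
Lemma even_rainbow : (0 < n)%N -> ~~ odd #|rainbow|.
Proof.
move=> n_gt0.
have neq_max : ord_max != ord0 :> 'I_n.+1 by rewrite -val_eqE /= -lt0n.
have even_door : ~~ odd #|[set x | door x]|.
  apply: (even_card_involution (f := pivot)) => x; rewrite !inE => dx.
  rewrite door_pivot pivotK; split=> //.
  apply/eqP => /(congr1 (fun y : V * 'S_n.+1 => y.2 ord0)); rewrite /= permM tpermL.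
  by move/perm_inj/eqP; rewrite (negbTE neq_max).
have even_other : ~~ odd #|[set x | door x && (label x 0 != 0)]|.
  apply: (even_card_involution (f := fun x => move_mark x (twin x))) => x.
  rewrite !inE => /andP[dx lx]; have [t0 et] := twinP dx lx.
  have l0 : label (move_mark x (twin x)) 0 = label x 0.
    by rewrite label_move_mark addr0.
  have dm : door (move_mark x (twin x)).
    (* The image of [n] positions has at most [n] elements, so it is enough that every non-zero
       label occurs; the label of the new mark occurs at the old one. *)
    rewrite /door eq_sym eqEcard; apply/andP; split; last first.
      by apply: leq_trans (leq_imset_card _ _) _.
    apply/subsetP => c; rewrite -{1}(eqP dx) => /imsetP[i i0 ->].
    have [->|it] := eqVneq i (twin x).
      apply/imsetP; exists (- twin x); first by rewrite !inE oppr_eq0.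
      by rewrite label_move_mark subrr.
    apply/imsetP; exists (i - twin x); first by rewrite !inE subr_eq0.
    by rewrite label_move_mark addrC subrK.
  have lm : label (move_mark x (twin x)) 0 != 0 by rewrite l0.
  have [t1 et1] := twinP dm lm.
  (* Labels are injective on the door, so the twin of the new mark is the old mark. *)
  have tt : twin x + twin (move_mark x (twin x)) = 0.
    apply/eqP; apply: contraNT t1 => t2.
    have := et1; rewrite l0 label_move_mark -et => /(door_inj dx) => e.
    have : twin x + twin (move_mark x (twin x)) = twin x + 0.
      by rewrite addr0; apply: e; rewrite !inE.
    by move/addrI/eqP.
  split; first by rewrite dm l0.
    apply/eqP => /(congr1 (fun y : V * 'S_n.+1 => y.2 ord0)); rewrite /= permM shift_permE.
    by move/perm_inj => e; move: t0; rewrite -(addrK (ord0 : 'I_n.+1) (twin x)) [X in X - _]e subrr eqxx.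
  rewrite {1}/move_mark walk_shift_ord tt walk0; case: (x) tt => v p tt /=.
  congr (_, _); apply/permP => i; rewrite !permM !shift_permE addrA.
  by rewrite tt add0r.
have := even_door; rewrite -(cardsID [set x | label x 0 == 0]).
have -> : [set x | door x] :&: [set x | label x 0 == 0] = rainbow.
  by apply/setP => x; rewrite !inE.
have -> : [set x | door x] :\: [set x | label x 0 == 0] =
          [set x | door x && (label x 0 != 0)].
  by apply/setP => x; rewrite !inE andbC.
by rewrite oddD (negbTE even_other) addbF.
Qed.

End Walks.

(** * Kuhn's triangulation of the discrete torus, and Sperner's lemma on a grid *)

Section Torus.

Import GRing.Theory.
Local Open Scope ring_scope.

Variables (n M : nat).
Hypotheses (n_gt0 : (0 < n)%N) (M_gt0 : (0 < M)%N).

Notation V := 'rV['I_M.+3]_n.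
Implicit Types (a v : V) (p : 'S_n.+1) (x : V * 'S_n.+1) (L : V -> 'I_n.+1).

(** The unit vectors and minus their sum: closed walks with these steps go round the simplices of
    Kuhn's triangulation. *)
Definition step (i : 'I_n.+1) : V :=
  if unlift ord0 i is Some k then delta_mx 0 k else const_mx (- 1).

Lemma sum_step : \sum_i step i = 0.
Proof.
rewrite big_ord_recl {1}/step unlift_none; apply/rowP => k.
rewrite !mxE summxE (bigD1 k) //= big1 ?addr0 => [|i ik].
  by rewrite /step liftK !mxE !eqxx addrC subrr.
by rewrite /step liftK !mxE eq_sym (negbTE ik) andbF.
Qed.

Definition time p (i : 'I_n.+1) : 'I_n.+1 := (p^-1)%g i.

Lemma walk_coord v p (j : 'I_n.+1) k :
  walk step v p j 0 k =
  v 0 k + (time p (lift ord0 k) < j)%N%:R - (time p ord0 < j)%N%:R.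
Proof.
rewrite /walk mxE -addrA; congr (_ + _).
rewrite big_mkord (big_ord_widen _ (fun i => step (p (inZp i))) (ltnW (ltn_ord j))).
rewrite (reindex_inj (perm_inj (s := (p^-1)%g))) /= summxE.
rewrite (eq_bigr (fun i => step i 0 k)); last first.
  by move=> i _; rewrite valZpK permKV.
rewrite big_mkcond big_ord_recl /= {1}/step unlift_none mxE addrC; congr (_ + _).
  rewrite (bigD1 k) //= big1 ?addr0 => [|i ik].
    by rewrite /step liftK mxE !eqxx /time; case: ifP.
  by rewrite /step liftK mxE eq_sym (negbTE ik) andbF; case: ifP.
by rewrite /time; case: ifP => _; rewrite ?oppr0.
Qed.

(* Along a cell the [k]-th coordinate takes only the values [low x k] and [low x k + 1]. *)
Definition low x (k : 'I_n) : 'I_M.+3 :=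
  if (time x.2 (lift ord0 k) < time x.2 ord0)%N then x.1 0 k else x.1 0 k - 1.

Lemma walk_low x (j : 'I_n.+1) k :
  walk step x.1 x.2 j 0 k = low x k \/ walk step x.1 x.2 j 0 k = low x k + 1.
Proof.
rewrite walk_coord /low; case: (ltnP (time x.2 (lift ord0 k)) (time x.2 ord0)) => lt1.
  case: (ltnP (time x.2 ord0) j) => lt2.
    by rewrite (ltn_trans lt1 lt2) addrK; left.
  rewrite subr0; case: ltnP => _; last by rewrite addr0; left.
  by right.
rewrite subrK; case: (ltnP (time x.2 (lift ord0 k)) j) => lt2.
  by rewrite (leq_ltn_trans lt1 lt2) addrK; right.
rewrite addr0; case: ltnP => _; first by left.
by rewrite subr0; right.
Qed.

Lemma low_start x k : x.1 0 k = low x k \/ x.1 0 k = low x k + 1.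
Proof. by rewrite /low; case: ifP => _; rewrite ?subrK; auto. Qed.

(** A reference labelling: it meets the boundary conditions and has exactly one rainbow cell that
    does not wrap around the torus. *)
Definition top_label a : 'I_n.+1 := inord (\max_(k < n | (1 < a 0%R k)%N) k.+1).

Lemma top_label_val a : top_label a = \max_(k < n | (1 < a 0%R k)%N) k.+1 :> nat.
Proof. by rewrite inordK // ltnS; apply/bigmax_leqP => k _. Qed.

Lemma top_label_lift a k : top_label a = lift ord0 k -> (1 < a 0%R k)%N.
Proof.
move/(congr1 val); rewrite /= top_label_val.
have [/pred0P no|] := boolP (pred0b [pred k : 'I_n | (1 < a 0%R k)%N]).
  by rewrite big_pred0.
rewrite /pred0b -lt0n => /eq_bigmax_cond-/(_ (fun k : 'I_n => k.+1))[i ai].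
rewrite (eq_bigl (fun k : 'I_n => (1 < a 0%R k)%N)) // => ->.
by rewrite /bump /= add1n => -[/ord_inj <-].
Qed.

Lemma top_label0 a k : top_label a = ord0 -> (a 0%R k <= 1)%N.
Proof.
move/(congr1 val); rewrite /= top_label_val => e.
rewrite leqNgt; apply/negP => ak.
by have := @leq_bigmax_cond _ (fun k : 'I_n => 1 < a 0%R k)%N
  (fun k : 'I_n => k.+1) k ak; rewrite e.
Qed.

(* Sperner boundary conditions; coordinates [0] and [M + 2] are the collar. *)
Definition admissible L :=
  (forall a k, L a = lift ord0 k -> (1 < a 0%R k)%N) /\
  (forall a k, L a = ord0 -> (a 0%R k <= M)%N).

Definition wraps x := [exists k, low x k == ord_max].

(** The label [lift ord0 k] needs a vertex with [k]-th coordinate at least 2, the label 0 one with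
    coordinate at most [M], and the coordinate takes only two consecutive values on the cell. *)
Lemma rainbow_low L x k : admissible L -> x \in rainbow step L -> ~~ wraps x ->
  (0 < low x k <= M)%N.
Proof.
move=> [Ll L0] rx /existsPn nw.
have lk : low x k != M.+2 :> nat by have := nw k; rewrite -val_eqE.
apply/andP; split; rewrite ?lt0n.
  apply/negP => /eqP l0.
  have [i /Ll] := rainbow_onto (lift ord0 k) rx.
  by case: (walk_low x i k) => ->; rewrite ?val_add1 l0.
have [i li] := rainbow_onto ord0 rx; have := L0 _ k li.
case: (walk_low x i k) => ->; rewrite ?val_add1 ?(negbTE lk) //.
by apply: ltnW.
Qed.

Definition origin : V := const_mx 1.

(** The step lowering all coordinates comes last, so the coordinates above 1 are exactly those
    raised so far. *)
Lemma top_label_walk p (j : 'I_n.+1) : p ord_max = ord0 ->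
  top_label (walk step origin p j) = \max_(i < n.+1 | (i < j)%N) p i :> nat.
Proof.
move=> pm; have t0 : time p ord0 = ord_max by rewrite /time -pm permK.
have nj : (time p ord0 < j)%N = false by rewrite t0 /=; move: (ltn_ord j); lia.
rewrite top_label_val (reindex_inj (perm_inj (s := (p^-1)%g))) /=.
rewrite [RHS](eq_bigr (fun i : 'I_n.+1 => i : nat)); last by move=> i _; rewrite permKV.
rewrite [RHS]big_mkcond big_ord_recl /= [X in _ = maxn X _](_ : _ = 0%N); last by case: ifP.
rewrite max0n big_mkcond; apply: eq_bigr => k _.
have -> : walk step origin p j 0 k = 1 + (time p (lift ord0 k) < j)%N%:R.
  by rewrite walk_coord nj subr0 mxE.
rewrite /time; case: (_ < j)%N; last by rewrite addr0.
by [].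
Qed.

Lemma inZpS (i : 'I_n.+1) : i != ord_max -> (inZp i.+1 : 'I_n.+1) = i.+1 :> nat.
Proof.
rewrite -val_eqE /= => ne; rewrite modn_small //.
by move: (ltn_ord i); lia.
Qed.

Definition origin_cell : V * 'S_n.+1 := (origin, shift_perm (inZp 1)).

Lemma shift1E (i : 'I_n.+1) : shift_perm (inZp 1) i = inZp i.+1.
Proof. by rewrite shift_permE -(add1n i) inZpD valZpK. Qed.

Lemma max_shift1 (j : 'I_n.+1) :
  \max_(i < n.+1 | (i < j)%N) shift_perm (inZp 1) i = j :> nat.
Proof.
rewrite (eq_bigr (fun i : 'I_n.+1 => i.+1)); last first.
  move=> i ij; rewrite shift1E inZpS // -val_eqE /=; move: (ltn_ord j); lia.
apply/eqP; rewrite eqn_leq; apply/andP; split; first by apply/bigmax_leqP.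
case: (posnP j) => [->//|j0].
have jn : (j.-1 < n.+1)%N by move: (ltn_ord j); lia.
have := @leq_bigmax_cond _ (fun i : 'I_n.+1 => (i < j)%N)
  (fun i : 'I_n.+1 => i.+1) (Ordinal jn).
by rewrite /= prednK //; apply.
Qed.

Lemma label_origin_cell j : label step top_label origin_cell j = j.
Proof.
apply: val_inj; rewrite /label [LHS]top_label_walk ?max_shift1 //.
by rewrite shift1E; apply: val_inj; rewrite /= modnn.
Qed.

Lemma origin_cell_rainbow : origin_cell \in rainbow step top_label.
Proof.
rewrite inE /door label_origin_cell eqxx andbT.
rewrite (eq_imset (g := id)) ?imset_id // => j.
exact: label_origin_cell.
Qed.

Lemma origin_cell_wraps : ~~ wraps origin_cell.
Proof.
apply/existsPn => k; rewrite /low /=.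
have -> : time (shift_perm (inZp 1)) ord0 = ord_max.
  apply: (perm_inj (s := shift_perm (inZp 1))); rewrite /time permKV shift1E.
  by apply: val_inj; rewrite /= modnn.
have -> : time (shift_perm (inZp 1)) (lift ord0 k) = widen_ord (leqnSn n) k.
  apply: (perm_inj (s := shift_perm (inZp 1))); rewrite /time permKV shift1E.
  apply: val_inj; rewrite /= modn_small // ltnS; exact: ltn_ord.
by rewrite /= ltn_ord mxE.
Qed.

Lemma incr_bounded_id (f : nat -> nat) :
  (forall j, (j < n)%N -> (f j < f j.+1)%N) -> (f n <= n)%N ->
  forall j, (j <= n)%N -> f j = j.
Proof.
move=> incr fn j jn.
have lo : (j <= f j)%N.
  by elim: j jn => // j IH jn; have := incr j jn; have := IH (ltnW jn); lia.
have hi : forall k, (k <= n)%N -> (f (n - k) + k <= n)%N.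
  elim=> [|k IH] kn; first by rewrite subn0 addn0.
  have := IH (ltnW kn); have := incr (n - k.+1)%N.
  have -> : (n - k.+1).+1 = (n - k)%N by lia.
  lia.
have := hi (n - j)%N (leq_subr _ _); rewrite subKn //; lia.
Qed.

Lemma top_label_admissible : admissible top_label.
Proof.
split=> [a k|a k /(@top_label0 _ k) h]; first exact: top_label_lift.
exact: leq_trans h M_gt0.
Qed.

(** The mark has label 0, which forces it to be [origin] and the lowering step to come last. The
    labels are then the running maxima of [p]; being distinct, they increase strictly from 0 to [n],
    which determines [p]. *)
Lemma top_rainbow_unique x :
  x \in rainbow step top_label -> ~~ wraps x -> x = origin_cell.
Proof.
move=> rx nw; have rxl k := rainbow_low k top_label_admissible rx nw.
have := rx; rewrite inE => /andP[dx /eqP lx0].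
case: x => v p in rx nw rxl dx lx0 *.
have v1 k : v 0%R k = 1%R /\ low (v, p) k = 1%R.
  have vk : (v 0%R k <= 1)%N by apply: top_label0; move: lx0; rewrite /label walk0.
  have := rxl k.
  case: (low_start (v, p) k) => /= e; move: vk; rewrite e ?val_add1.
    by move=> h1 h2; split; apply: val_inj; rewrite /= modn_small //; lia.
  case: eqP; lia.
have vE : v = origin by apply/rowP => k; rewrite mxE; case: (v1 k).
have pm : p ord_max = ord0.
  have late k : (time p (lift ord0 k) < time p ord0)%N.
    have [e1 e2] := v1 k; move: e2; rewrite /low /= e1; case: ifP => // _.
    by move/(congr1 val); rewrite subrr /= modn_small.
  have [-> |t0] := eqVneq (ord_max : 'I_n.+1) (time p ord0); first by rewrite /time permKV.
  have [k pk|pk] := unliftP ord0 (p ord_max); last exact: pk.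
  have := late k; rewrite -pk /time permK /=; move: (ltn_ord ((p^-1)%g ord0)); lia.
congr (_, _) => //; apply/permP => i; rewrite shift1E.
pose f j := \max_(i < n.+1 | (i < j)%N) p i.
have lab (j : 'I_n.+1) : label step top_label (v, p) j = f j :> nat.
  by rewrite /label vE top_label_walk.
have fS (j : 'I_n.+1) : f j.+1 = maxn (f j) (p j).
  rewrite /f (bigD1 j) //= maxnC; congr maxn; apply: eq_bigl => k.
  by rewrite -val_eqE /=; lia.
have labI (j k : 'I_n.+1) : f j = f k -> j = k.
  have l0 (l : 'I_n.+1) : l != ord0 -> f l <> f (ord0 : 'I_n.+1).
    move=> lN0 e; have: label step top_label (v, p) l \in [set~ 0].
      by rewrite -(eqP dx); apply: imset_f; rewrite !inE.
    rewrite !inE => /eqP; apply; apply: val_inj; rewrite /= lab e /f. by rewrite big_pred0.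
  have [->|j0] := eqVneq j ord0; have [->|k0] := eqVneq k ord0 => // e.
  - by case: (l0 k k0).
  - by case: (l0 j j0).
  by apply: (door_inj dx); rewrite ?inE //; apply: val_inj; rewrite /= !lab.
have fid : forall j, (j <= n)%N -> f j = j.
  apply: incr_bounded_id => [j jn|]; last first.
    by apply/bigmax_leqP => k _; rewrite -ltnS.
  have jn1 : (j < n.+1)%N by apply: ltnW.
  have := fS (Ordinal jn1) => /= e.
  have ne : f j <> f j.+1.
    by move=> /(@labI (Ordinal jn1) (Ordinal (jn : (j.+1 < n.+1)%N))) /(congr1 val) /=; lia.
  lia.
have [->|im] := eqVneq i ord_max.
  by rewrite pm; apply: val_inj; rewrite /= modnn.
apply: ord_inj; rewrite (inZpS im).
have iS : (i.+1 <= n)%N by move: im; rewrite -val_eqE /=; move: (ltn_ord i); lia.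
have := fS i; rewrite !fid //; [|lia].
by rewrite /=; lia.
Qed.

Definition collar a := [exists k, (a 0%R k == 0%R) || (a 0%R k == ord_max)].

(* Relabel the collar by [top_label]. The cells wrapping around the torus then
   carry the same labels for both labellings, both rainbow counts are even, and
   [top_label] has exactly one nonwrapping rainbow cell; so [L] has an odd number
   of them, all inside the collar. *)
Lemma interior_rainbow L :
  (forall a k, ~~ collar a -> L a = lift ord0 k -> (1 < a 0%R k)%N) ->
  (forall a k, ~~ collar a -> L a = ord0 -> (a 0%R k <= M)%N) ->
  exists x, (forall k, 0 < low x k <= M)%N /\
    (forall c, exists i : 'I_n.+1, L (walk step x.1 x.2 i) = c).
Proof.
move=> Ll L0; pose L' a := if collar a then top_label a else L a.
have L'ad : admissible L'.
  have [Tl T0] := top_label_admissible.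
  by split=> a k; rewrite /L'; case: ifPn; auto.
have wrapE x : wraps x -> (x \in rainbow step L') = (x \in rainbow step top_label).
  move=> /existsP[k /eqP lk].
  have e i : label step L' x i = label step top_label x i.
    rewrite /label /L' ifT //; apply/existsP; exists k.
    case: (walk_low x i k) => ->; rewrite lk ?eqxx ?orbT //.
    apply/orP; left; apply/eqP/val_inj => /=.
    by rewrite (modn_small (m := 1)) // addn1 modnn.
  by rewrite !inE /door e (eq_imset _ e).
pose W := [set x | wraps x].
have eW : rainbow step L' :&: W = rainbow step top_label :&: W.
  apply/setP => x; rewrite !in_setI [x \in W]inE.
  by case: (boolP (wraps x)) => [/wrapE ->|_] //; rewrite !andbF.
have e1 : rainbow step top_label :\: W = [set origin_cell].
  apply/setP => x; rewrite in_setD in_set1 [x \in W]inE.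
  apply/andP/eqP => [[nw rx]|->]; first exact: top_rainbow_unique.
  by rewrite origin_cell_wraps origin_cell_rainbow.
have := even_rainbow sum_step L' n_gt0; have := even_rainbow sum_step top_label n_gt0.
rewrite -(cardsID W) -(cardsID W (rainbow step L')) !oddD eW e1 cards1.
case: (odd _) => //= _ => odd1.
have [e|[x]] := set_0Vmem (rainbow step L' :\: W); first by rewrite e cards0 in odd1.
rewrite in_setD [x \in W]inE => /andP[nw rx].
have lx k := rainbow_low k L'ad rx nw.
exists x; split=> // c; have [i <-] := rainbow_onto c rx; exists i.
rewrite /label /L' ifN //; apply/existsPn => k; have := lx k.
case: (walk_low x i k) => ->; rewrite -!val_eqE /= => h.
  by apply/norP; split; lia.
rewrite (modn_small (m := 1)) // modn_small; last by lia.
by apply/norP; split; lia.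
Qed.

End Torus.

(** The grid occupies the torus coordinates 1 to [M + 1], shifted back by [.-1]; the remaining
    values 0 and [M + 2] form the collar. *)
Lemma sperner_grid (n M : nat) (L : ('I_n -> nat) -> 'I_n.+1) :
  (0 < n)%N -> (0 < M)%N ->
  (forall a k, (forall i, a i <= M)%N -> L a = lift ord0 k -> (0 < a k)%N) ->
  (forall a k, (forall i, a i <= M)%N -> L a = ord0 -> (a k < M)%N) ->
  exists q : 'I_n.+1 -> 'I_n -> nat,
    [/\ forall c k, (q c k <= M)%N,
        forall c c' k, (q c k <= (q c' k).+1)%N & forall c, L (q c) = c].
Proof.
move=> n0 M0 Ll L0.
pose pt (a : 'rV['I_M.+3]_n) : 'I_n -> nat := fun k => (a 0%R k).-1.
have ptM a : ~~ collar a -> forall k, (pt a k <= M)%N.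
  move=> /existsPn h k; have := h k; rewrite -!val_eqE /pt /= => /norP[_ h2].
  by have := ltn_ord (a 0%R k); lia.
have [||x [lx lab]] := @interior_rainbow n M n0 M0 (fun a => L (pt a)).
- by move=> a k /ptM h /(Ll _ _ h); rewrite /pt; lia.
- by move=> a k /ptM h /(L0 _ k h); rewrite /pt; lia.
have [i iP] := fin_all_exists lab.
have near c k : pt (walk (@step n M) x.1 x.2 (i c)) k = (low x k).-1 \/
                pt (walk (@step n M) x.1 x.2 (i c)) k = low x k.
  rewrite /pt; have := lx k => lxk.
  case: (walk_low x (i c) k) => ->; first by left.
  by right; rewrite val_add1; case: eqP; lia.
exists (fun c => pt (walk (@step n M) x.1 x.2 (i c))); split=> //.
- by move=> c k; have := lx k; case: (near c k) => ->; lia.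
- by move=> c c' k; case: (near c k) => ->; case: (near c' k) => ->; lia.
Qed.

(** * Covers of the cube *)

Local Open Scope R_scope.

Definition in_cube (n : nat) (t : 'I_n -> R) := forall k, 0 <= t k <= 1.

(** Coquelicot states compactness of boxes for nested pairs; [tuple_of] and [fun_of] translate. *)
Fixpoint tuple_of (n : nat) : ('I_n -> R) -> Compactness.Tn n R :=
  match n return ('I_n -> R) -> Compactness.Tn n R with
  | 0 => fun _ => tt
  | m.+1 => fun t => (t ord0, tuple_of (fun k => t (lift ord0 k)))
  end.

Fixpoint fun_of (n : nat) : Compactness.Tn n R -> 'I_n -> R :=
  match n return Compactness.Tn n R -> 'I_n -> R with
  | 0 => fun _ _ => 0
  | m.+1 => fun x k => if unlift ord0 k is Some j then fun_of x.2 j else x.1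
  end.

Lemma bounded_tuple_of n (t : 'I_n -> R) : in_cube t ->
  Compactness.bounded_n n (tuple_of (fun _ => 0)) (tuple_of (fun _ => 1)) (tuple_of t).
Proof.
elim: n t => [|n IH] t ct //=; split; first exact: ct.
by apply: IH => k; apply: ct.
Qed.

Lemma bounded_fun_of n (x : Compactness.Tn n R) :
  Compactness.bounded_n n (tuple_of (fun _ => 0)) (tuple_of (fun _ => 1)) x ->
  in_cube (fun_of x).
Proof.
elim: n x => [|n IH] /=; first by move=> _ _ [].
case=> x1 x2 /= [b1 b2] k; case: unliftP => [j _|_] //; exact: IH.
Qed.

Lemma close_tuple_of n e (t : 'I_n -> R) (x : Compactness.Tn n R) :
  Compactness.close_n n e (tuple_of t) x -> forall k, Rabs (t k - fun_of x k) < e.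
Proof.
elim: n t x => [|n IH] t /=; first by move=> _ _ [].
case=> x1 x2 /= [c1 c2] k; case: unliftP => [j ->|->] //.
exact: (IH (fun k => t (lift ord0 k))).
Qed.

(** Compactness for gauges: [delta] may come arbitrarily close to 0, yet centres whose radius is
    bounded below suffice. For a gauge subordinate to a cover, [rho] acts as a Lebesgue number. *)
Lemma lebesgue_number (n : nat) (delta : ('I_n -> R) -> R) :
  (forall t, 0 < delta t) ->
  exists rho, 0 < rho /\ forall t, in_cube t -> exists s,
    in_cube s /\ (forall k, Rabs (t k - s k) < delta s) /\ rho <= delta s.
Proof.
move=> d0.
have [rho rhoP] := Compactness.compactness_value n (tuple_of (fun _ => 0))
  (tuple_of (fun _ => 1)) (fun x => mkposreal _ (d0 (fun_of x))).
exists rho; split=> [|t ct]; first exact: cond_pos.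
apply: NNPP => no; apply: (rhoP _ (bounded_tuple_of ct)) => -[s [bs [cs rs]]].
apply: no; exists (fun_of s); split; first exact: bounded_fun_of.
by split=> //; exact: close_tuple_of.
Qed.

(** * Finite sums of reals as iterated monoid operations *)

Lemma RplusA : associative Rplus. Proof. by move=> x y z; lra. Qed.
Lemma RplusC : commutative Rplus. Proof. by move=> x y; lra. Qed.
Lemma Rplus0 : left_id 0 Rplus. Proof. by move=> x; lra. Qed.
HB.instance Definition _ := Monoid.isComLaw.Build R 0 Rplus RplusA RplusC Rplus0.
Lemma Rmult0l : left_zero 0 Rmult. Proof. by move=> x; lra. Qed.
Lemma Rmult0r : right_zero 0 Rmult. Proof. by move=> x; lra. Qed.
HB.instance Definition _ := Monoid.isMulLaw.Build R 0 Rmult Rmult0l Rmult0r.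
Lemma RmultDl : left_distributive Rmult Rplus. Proof. by move=> x y z; lra. Qed.
Lemma RmultDr : right_distributive Rmult Rplus. Proof. by move=> x y z; lra. Qed.
HB.instance Definition _ := Monoid.isAddLaw.Build R Rmult Rplus RmultDl RmultDr.

Section SumR.
Variable n : nat.
Implicit Types f g : 'I_n -> R.

Lemma sumR_eq f g : (forall i, f i = g i) -> sumR f = sumR g.
Proof. by move=> e; apply: eq_bigr => i _; exact: e. Qed.

Lemma sumR_add f g : sumR (fun i => f i + g i) = sumR f + sumR g.
Proof. exact: big_split. Qed.

Lemma sumR_scal c f : sumR (fun i => c * f i) = c * sumR f.
Proof. by rewrite /sumR big_distrr. Qed.

Lemma sumR_le f g : (forall i, f i <= g i) -> sumR f <= sumR g.
Proof.
move=> le; apply: (big_ind2 (fun x y => x <= y)) => //; first lra.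
by move=> *; lra.
Qed.

Lemma sumR_const c : sumR (fun _ : 'I_n => c) = INR n * c.
Proof.
rewrite /sumR big_const card_ord; elim: n => [|m IH] /=; first lra.
by rewrite IH -/(INR m.+1) S_INR; lra.
Qed.

Lemma sumR_ge0 f : (forall i, 0 <= f i) -> 0 <= sumR f.
Proof. by move=> f0; have := sumR_le f0; rewrite sumR_const; lra. Qed.

Lemma sumR_ge f i : (forall j, 0 <= f j) -> f i <= sumR f.
Proof.
move=> f0; rewrite /sumR (bigD1 i) //=.
rewrite -[X in X <= _]Rplus_0_r; apply: Rplus_le_compat_l.
by apply: big_ind => //; [lra | move=> *; lra].
Qed.

Lemma Rabs_sumR f : Rabs (sumR f) <= sumR (fun i => Rabs (f i)).
Proof.
apply: (big_ind2 (fun x y => Rabs x <= y)); first by rewrite Rabs_R0; lra.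
  by move=> x1 y1 x2 y2 h1 h2; have := Rabs_triang x1 x2; lra.
by move=> *; lra.
Qed.

End SumR.

Lemma sumR_recl n (f : 'I_n.+1 -> R) :
  sumR f = f ord0 + sumR (fun i => f (lift ord0 i)).
Proof. by rewrite /sumR big_ord_recl. Qed.

Lemma catI_lshift T n m (a : 'I_n -> T) (b : 'I_m -> T) i : catI a b (lshift m i) = a i.
Proof. by rewrite /catI; case: (split (lshift m i)) (splitK (lshift m i)) => j /= e;
 [have /lshift_inj -> := e | have := eq_lrshift i j; rewrite -e eqxx]. Qed.

Lemma catI_rshift T n m (a : 'I_n -> T) (b : 'I_m -> T) i : catI a b (rshift n i) = b i.
Proof. by rewrite /catI; case: (split (rshift n i)) (splitK (rshift n i)) => j /= e;
 [have := eq_lrshift j i; rewrite -e eqxx | have /rshift_inj -> := e]. Qed.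

Lemma sumR_catI n m (a : 'I_n -> R) (b : 'I_m -> R) : sumR (catI a b) = sumR a + sumR b.
Proof.
rewrite /sumR big_split_ord; congr (_ + _); apply: eq_bigr => i _.
  exact: catI_lshift.
exact: catI_rshift.
Qed.

(* The dual, open form of the Knaster-Kuratowski-Mazurkiewicz lemma, on a cube. *)
Lemma kkm_cube (n : nat) (W : 'I_n.+1 -> ('I_n -> R) -> Prop) :
  (0 < n)%nat ->
  (forall t, in_cube t -> exists i delta, 0 < delta /\
     forall t', in_cube t' -> (forall k, Rabs (t' k - t k) < delta) -> W i t') ->
  (forall t k, in_cube t -> W (lift ord0 k) t -> 0 < t k) ->
  (forall t k, in_cube t -> W ord0 t -> t k < 1) ->
  exists t, in_cube t /\ forall i, W i t.
Proof.
move=> n0 Wo Wl W0.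
have [delta dP] : exists delta : ('I_n -> R) -> R, forall t, 0 < delta t /\
    (in_cube t -> exists i, forall t', in_cube t' ->
       (forall k, Rabs (t' k - t k) < 2 * delta t) -> W i t').
  apply: (functional_choice (fun t d => 0 < d /\ (in_cube t -> exists i,
    forall t', in_cube t' -> (forall k, Rabs (t' k - t k) < 2 * d) -> W i t'))) => t.
  case: (classic (in_cube t)) => [/Wo[i [d [d0 dW]]]|nt]; last by exists 1; split; [lra|].
  (* Halving leaves room for a ball of radius [rho] around any point that is [delta s]-close to
     [s]. *)
  exists (d / 2); split=> [|_]; first lra.
  by exists i => t' ct' h; apply: dW => // k; have := h k; lra.
have [rho [rho0 rhoP]] := lebesgue_number (fun t => proj1 (dP t)).
have [M [Mrho M0]] : exists M, / INR M < rho /\ (0 < M)%nat.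
  by have [M [h1 h2]] := archimed_cor1 _ rho0; exists M; split=> //; apply/ltP.
have Mpos : 0 < INR M by apply/lt_0_INR/ltP.
pose pt (a : 'I_n -> nat) k := INR (a k) / INR M.
have ptE a k : INR (a k) = pt a k * INR M by rewrite /pt; field; lra.
have ptc a : (forall k, (a k <= M)%nat) -> in_cube (pt a).
  move=> aM k; rewrite /pt; split; first by apply: Rle_mult_inv_pos => //; exact: pos_INR.
  apply: (Rmult_le_reg_r (INR M)) => //; rewrite -/(pt a k) -ptE Rmult_1_l.
  exact/le_INR/leP.
(* A grid point is labelled by a [W i] containing its whole [rho]-ball in the cube; off the grid the
   label is the default [ord0]. *)
have [L LP] : exists L : ('I_n -> nat) -> 'I_n.+1, forall a, (forall k, (a k <= M)%nat) ->
    forall t, in_cube t -> (forall k, Rabs (t k - pt a k) < rho) -> W (L a) t.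
  apply: (functional_choice (fun a i => (forall k, (a k <= M)%nat) ->
    forall t, in_cube t -> (forall k, Rabs (t k - pt a k) < rho) -> W i t)) => a.
  case: (classic (forall k, (a k <= M)%nat)) => [aM|?]; last by exists ord0.
  have [s [cs [hs rs]]] := rhoP _ (ptc _ aM).
  have [_ /(_ cs) [i iP]] := dP s; exists i => _ t ct ht; apply: iP => // k.
  have := Rabs_triang (t k - pt a k) (pt a k - s k).
  have -> : t k - pt a k + (pt a k - s k) = t k - s k by lra.
  by have := hs k; have := ht k; lra.
have Lself a : (forall k, (a k <= M)%nat) -> W (L a) (pt a).
  move=> aM; apply: LP => //; first exact: ptc.
  by move=> k; rewrite Rminus_diag Rabs_R0.
have [||q [qM qq qL]] := sperner_grid (L := L) n0 M0.
- move=> a k aM La; have := Lself a aM; rewrite La => /(Wl _ _ (ptc a aM)) h.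
  by apply/ltP/INR_lt; rewrite ptE; have := Rmult_lt_0_compat _ _ h Mpos; rewrite /=; lra.
- move=> a k aM La; have := Lself a aM; rewrite La => /(W0 _ k (ptc a aM)) h.
  apply/ltP/INR_lt; rewrite ptE.
  by have := Rmult_lt_compat_r _ _ _ Mpos h; lra.
have qc c : in_cube (pt (q c)) by apply: ptc; exact: qM.
(* The vertices of the rainbow cell differ by at most [1 / M < rho] in each coordinate, so this one
   lies in the [rho]-balls of all. *)
exists (pt (q ord0)); split=> // c; rewrite -(qL c); apply: LP => // k.
have h1 := le_INR _ _ (elimT leP (qq ord0 c k)).
have h2 := le_INR _ _ (elimT leP (qq c ord0 k)).
rewrite !S_INR !ptE in h1 h2.
apply: Rle_lt_trans Mrho; apply: Rabs_le.
have e : / INR M * INR M = 1 by apply: Rinv_l; lra.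
by split; apply: (Rmult_le_reg_r (INR M)) => //; nra.
Qed.

(** * Independent tuples and covering dimension *)

(** Barycentric coordinates where [sumR t <= 1]; beyond, the point is projected radially onto the
    facet opposite to vertex 0. A non-zero weight at [ord0] thus forces all [t k < 1], and one at
    [lift ord0 k] forces [0 < t k], as [kkm_cube] requires. *)
Definition simplex_point (n : nat) (t : 'I_n -> R) (i : 'I_n.+1) : R :=
  if unlift ord0 i is Some k then t k / Rmax 1 (sumR t) else Rmax 0 (1 - sumR t).

Section SimplexPoint.
Variable n : nat.
Implicit Types t : 'I_n -> R.

Lemma simplex_point0 t : simplex_point t ord0 = Rmax 0 (1 - sumR t).
Proof. by rewrite /simplex_point unlift_none. Qed.

Lemma simplex_point_lift t k : simplex_point t (lift ord0 k) = t k / Rmax 1 (sumR t).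
Proof. by rewrite /simplex_point liftK. Qed.

Lemma simplex_point_prob t : in_cube t -> Prob (simplex_point t).
Proof.
move=> ct; have S0 : 0 <= sumR t by apply: sumR_ge0 => k; apply: (proj1 (ct k)).
have m1 := Rmax_l 1 (sumR t); split.
  move=> i; case: (unliftP ord0 i) => [k ->|->].
    by rewrite simplex_point_lift; apply: Rle_mult_inv_pos; [apply: (proj1 (ct k))|lra].
  by rewrite simplex_point0; exact: Rmax_l.
have -> : sumR (simplex_point t) = Rmax 0 (1 - sumR t) + / Rmax 1 (sumR t) * sumR t.
  rewrite sumR_recl simplex_point0 -sumR_scal; congr (_ + _).
  by apply: sumR_eq => k; rewrite simplex_point_lift Rmult_comm.
case: (Rle_lt_dec (sumR t) 1) => h.
  by rewrite Rmax_right ?Rmax_left; lra.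
by rewrite Rmax_left ?Rmax_right; [field | |]; lra.
Qed.

(** The sum moves by at most [n e], hence weight 0 by [n e] and each other weight by [(1 + n) e];
    these bounds add up to [n (n + 2) e]. *)
Lemma simplex_point_dist t t' e : in_cube t -> in_cube t' ->
  (forall k, Rabs (t k - t' k) <= e) ->
  l1dist (simplex_point t) (simplex_point t') <= INR n * (INR n + 2) * e.
Proof.
move=> ct ct' te; have n0 := pos_INR n.
have Se : Rabs (sumR t - sumR t') <= INR n * e.
  have -> : sumR t - sumR t' = sumR (fun k => t k - t' k).
    have -> : sumR t - sumR t' = sumR t + -1 * sumR t' by lra.
    by rewrite -sumR_scal -sumR_add; apply: sumR_eq => k; lra.
  by apply: Rle_trans (Rabs_sumR _) _; rewrite -sumR_const; exact: sumR_le.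
rewrite /l1dist sumR_recl !simplex_point0.
have h0 : Rabs (Rmax 0 (1 - sumR t) - Rmax 0 (1 - sumR t')) <= INR n * e.
  by apply: Rle_trans Se; rewrite /Rmax; do 2! case: Rle_dec => ?; split_Rabs; lra.
suff hk k : Rabs (simplex_point t (lift ord0 k) - simplex_point t' (lift ord0 k))
    <= e + INR n * e.
  have -> : INR n * (INR n + 2) * e = INR n * e + INR n * (e + INR n * e) by ring.
  by rewrite -(sumR_const n (e + INR n * e)); apply: Rplus_le_compat h0 (sumR_le hk).
rewrite !simplex_point_lift.
have hm : Rabs (Rmax 1 (sumR t') - Rmax 1 (sumR t)) <= INR n * e.
  by apply: Rle_trans Se; rewrite /Rmax; do 2! case: Rle_dec => ?; split_Rabs; lra.
have inv m : 1 <= m -> 0 < / m <= 1.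
  move=> m1; split; first by apply: Rinv_0_lt_compat; lra.
  by rewrite -Rinv_1; apply: Rinv_le_contravar; lra.
have m1 := Rmax_l 1 (sumR t); have m1' := Rmax_l 1 (sumR t').
move: (Rmax 1 (sumR t)) (Rmax 1 (sumR t')) m1 m1' hm => m m' m1 m1' hm.
have [i0 i1] := inv _ m1; have [i0' i1'] := inv _ m1'.
have -> : t k / m - t' k / m' = (t k - t' k) * / m + t' k * / m' * / m * (m' - m).
  by field; lra.
apply: Rle_trans (Rabs_triang _ _) _; rewrite !Rabs_mult.
rewrite (Rabs_pos_eq (/ m)) ?(Rabs_pos_eq (/ m')) ?(Rabs_pos_eq (t' k)); try lra; last first.
  by have := ct' k; lra.
have [t0 t1] := ct' k.
have b : 0 <= t' k * / m' * / m <= 1.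
  have : 0 <= t' k * / m' <= 1 by nra.
  nra.
have := Rabs_pos (t k - t' k); have := Rabs_pos (m' - m); have := te k; nra.
Qed.

End SimplexPoint.

Section Convex.

Variables (X : Type) (d : X -> X -> R) (gamma : gamma_type X).
Hypotheses (metric_d : is_metric d) (conv : convex_like d gamma).

Lemma dist_ge0 x y : 0 <= d x y. Proof. by case: metric_d. Qed.
Lemma dist_eq0 x y : d x y = 0 <-> x = y. Proof. by case: metric_d => _ []. Qed.
Lemma dist_refl x : d x x = 0. Proof. exact/dist_eq0. Qed.
Lemma dist_sym x y : d x y = d y x. Proof. by case: metric_d => _ [_ []]. Qed.
Lemma dist_tri x y z : d x z <= d x y + d y z. Proof. by case: metric_d => _ [_ []]. Qed.

Lemma gamma_vertex n (mu : 'I_n -> R) x i : Prob mu -> mu i = 1 -> gamma mu x = x i.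
Proof. by case: conv => _ [_ [_ [h _]]]; exact: h. Qed.

Lemma gamma_perm n (mu : 'I_n -> R) (x : 'I_n -> X) (p : 'S_n) : Prob mu ->
  gamma mu x = gamma (fun i => mu (p i)) (fun i => x (p i)).
Proof.
case: conv => _ [h _] P; apply: h => //.
exact: injF_bij (@perm_inj _ p).
Qed.

Lemma gamma_merge m (mu : 'I_m.+2 -> R) (x : 'I_m.+2 -> X) : Prob mu ->
  x ord0 = x (lift ord0 ord0) -> gamma mu x = gamma (merge12 mu) (drop2 x).
Proof. by case: conv => _ [_ [h _]]; exact: h. Qed.

Lemma gamma_lipschitz_weights n : exists C, 0 <= C /\ forall mu nu (x : 'I_n -> X),
  Prob mu -> Prob nu -> d (gamma mu x) (gamma nu x) <= C * l1dist mu nu.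
Proof.
case: conv => _ [_ [_ [_ [/(_ n)[C CP] _]]]].
exists (Rabs C); split=> [|mu nu x Pm Pn]; first exact: Rabs_pos.
apply: Rle_trans (CP _ _ _ Pm Pn) _; apply: Rmult_le_compat_r; last exact: Rle_abs.
by apply: sumR_ge0 => i; exact: Rabs_pos.
Qed.

Lemma gamma_lipschitz n (mu : 'I_n -> R) x y : Prob mu ->
  d (gamma mu x) (gamma mu y) <= sumR (fun i => mu i * d (x i) (y i)).
Proof. by case: conv => _ [_ [_ [_ [_ [h _]]]]]; exact: h. Qed.

Lemma gamma_assoc n m (nu : 'I_2 -> R) (mu : 'I_n -> R) (mu' : 'I_m -> R) x x' :
  Prob nu -> Prob mu -> Prob mu' ->
  gamma nu (fun k : 'I_2 => if k == ord0 then gamma mu x else gamma mu' x')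
  = gamma (catI (fun i => nu ord0 * mu i) (fun j => nu ord_max * mu' j)) (catI x x').
Proof. by case: conv => _ [_ [_ [_ [_ [_ h]]]]]; exact: h. Qed.

(* Some facet of the simplex spanned by [x] stays away from any given point: this replaces affine independence. *)
Definition independent n (x : 'I_n -> X) := forall p, exists i r, 0 < r /\
  forall mu, Prob mu -> mu i = 0 -> r <= d p (gamma mu x).

(** Independence says that the sets of points away from the facets cover [X]. A common point of all
    [W i], for a refinement pulled back along [F], lies in members assigned to each of the [N + 2]
    indices, and these members are distinct. *)
Lemma covering_dim_not_independent N (x : 'I_N.+2 -> X) :
  covering_dim_le d N -> ~ independent x.
Proof.
move=> dimN indx.
have [k [V [Vo [Vc [VU Vord]]]]] := dimN N.+2 (fun i p => exists r, 0 < r /\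
    forall mu, Prob mu -> mu i = 0 -> r <= d p (gamma mu x)) ltac:(
  move=> i p [r [r0 rP]]; exists (r / 2); split=> [|q pq]; [lra|];
  exists (r / 2); split=> [|mu Pm m0]; [lra|];
  have := rP mu Pm m0; have := dist_tri p q (gamma mu x); lra) indx.
have [c cP] := fin_all_exists VU.
pose F (t : 'I_N.+1 -> R) := gamma (simplex_point t) x.
pose W (i : 'I_N.+2) (t : 'I_N.+1 -> R) := exists j, c j = i /\ V j (F t).
(* With weight 0 at [i], the point [F t] would lie in the facet that it is supposed to avoid. *)
have Wpos i t : in_cube t -> W i t -> simplex_point t i <> 0.
  move=> ct [j [<- /(cP j) [r [r0 rP]]]] z.
  by have := rP _ (simplex_point_prob ct) z; rewrite dist_refl; lra.
have [||||t [ct Wt]] := @kkm_cube N.+1 W.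
- by [].
- move=> t ct; have [j Vj] := Vc (F t); have [r [r0 rP]] := Vo j _ Vj.
  have [C [C0 CP]] := gamma_lipschitz_weights N.+2.
  pose K := INR N.+1 * (INR N.+1 + 2).
  have K0 : 0 <= K by rewrite /K; have := pos_INR N.+1; nra.
  (* [C * K] is a Lipschitz constant of [F]; adding 1 keeps the denominator positive. *)
  have D0 : 0 < C * K + 1 by have := Rmult_le_pos _ _ C0 K0; lra.
  exists (c j), (r / (C * K + 1)); split=> [|t' ct' tt']; first exact: Rdiv_lt_0_compat.
  exists j; split=> //; apply: rP.
  apply: Rle_lt_trans (CP _ _ _ (simplex_point_prob ct) (simplex_point_prob ct')) _.
  have le : l1dist (simplex_point t) (simplex_point t') <= K * (r / (C * K + 1)).
    apply: simplex_point_dist => // i.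
    by rewrite Rabs_minus_sym; apply: Rlt_le; exact: tt'.
  apply: Rle_lt_trans (Rmult_le_compat_l _ _ _ C0 le) _.
  have e : r / (C * K + 1) * (C * K + 1) = r by field; lra.
  have := Rdiv_lt_0_compat _ _ r0 D0; nra.
- move=> t i ct /(Wpos _ _ ct); rewrite simplex_point_lift => ne.
  have [[ti|e] _] := ct i; first exact: ti.
  by case: ne; rewrite -e /Rdiv Rmult_0_l.
- move=> t i ct /(Wpos _ _ ct); rewrite simplex_point0 => ne.
  apply: Rnot_le_lt => ti; apply: ne; apply: Rmax_left.
  have := @sumR_ge _ t i (fun k => proj1 (ct k)); lra.
have [f fP] := fin_all_exists Wt.
apply: (Vord (F t) f) => [i i' e|i]; last by case: (fP i).
by case: (fP i) => <- _; case: (fP i') => <- _; rewrite e.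
Qed.

End Convex.

(** * Cancellation *)

Definition vec (T : Type) (n : nat) (x0 : T) (s : seq T) : 'I_n -> T :=
  fun i => nth x0 s i.

Lemma Prob2 a b : 0 <= a -> 0 <= b -> a + b = 1 -> Prob (@vec R 2 0 [:: a; b]).
Proof.
move=> a0 b0 ab; split; first by case=> [[|[|//]] ?].
by rewrite /sumR !big_ord_recl big_ord0 /vec /=; lra.
Qed.

Lemma Prob3 a b c : 0 <= a -> 0 <= b -> 0 <= c -> a + b + c = 1 ->
  Prob (@vec R 3 0 [:: a; b; c]).
Proof.
move=> a0 b0 c0 abc; split; first by case=> [[|[|[|//]]] ?].
by rewrite /sumR !big_ord_recl big_ord0 /vec /=; lra.
Qed.

Lemma Prob4 a b c e : 0 <= a -> 0 <= b -> 0 <= c -> 0 <= e -> a + b + c + e = 1 ->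
  Prob (@vec R 4 0 [:: a; b; c; e]).
Proof.
move=> a0 b0 c0 e0 abc; split; first by case=> [[|[|[|[|//]]]] ?].
by rewrite /sumR !big_ord_recl big_ord0 /vec /=; lra.
Qed.

Section Mix.

Variables (X : Type) (d : X -> X -> R) (gamma : gamma_type X).
Hypotheses (metric_d : is_metric d) (conv : convex_like d gamma).

Definition mix2 a b (x y : X) := gamma (@vec R 2 0 [:: a; b]) (vec x [:: x; y]).
Definition mix3 a b c (x y z : X) := gamma (@vec R 3 0 [:: a; b; c]) (vec x [:: x; y; z]).
Definition mix4 a b c e (x y z t : X) :=
  gamma (@vec R 4 0 [:: a; b; c; e]) (vec x [:: x; y; z; t]).

Lemma mix4_swap12 a b c e x y z t :
  0 <= a -> 0 <= b -> 0 <= c -> 0 <= e -> a + b + c + e = 1 ->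
  mix4 a b c e x y z t = mix4 a c b e x z y t.
Proof.
move=> a0 b0 c0 e0 s1; rewrite /mix4.
rewrite (gamma_perm conv _ (tperm (inord 1) (inord 2)) (Prob4 a0 b0 c0 e0 s1)).
congr gamma; apply: functional_extensionality => -[[|[|[|[|//]]]] i];
  by rewrite permE /vec /= -!val_eqE /= !inordK.
Qed.

Lemma mix4_swap13 a b c e x y z t :
  0 <= a -> 0 <= b -> 0 <= c -> 0 <= e -> a + b + c + e = 1 ->
  mix4 a b c e x y z t = mix4 a e c b x t z y.
Proof.
move=> a0 b0 c0 e0 s1; rewrite /mix4.
rewrite (gamma_perm conv _ (tperm (inord 1) (inord 3)) (Prob4 a0 b0 c0 e0 s1)).
congr gamma; apply: functional_extensionality => -[[|[|[|[|//]]]] i];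
  by rewrite permE /vec /= -!val_eqE /= !inordK.
Qed.

Lemma mix3_rot a b c x y z : 0 <= a -> 0 <= b -> 0 <= c -> a + b + c = 1 ->
  mix3 a b c x y z = mix3 b c a y z x.
Proof.
move=> a0 b0 c0 s1; rewrite /mix3.
rewrite (gamma_perm conv _ (shift_perm (inord 1)) (Prob3 a0 b0 c0 s1)).
congr gamma; apply: functional_extensionality => -[[|[|[|//]]] i];
  by rewrite shift_permE /vec /= !inordK.
Qed.

Lemma mix4_merge a b c e x y z :
  0 <= a -> 0 <= b -> 0 <= c -> 0 <= e -> a + b + c + e = 1 ->
  mix4 a b c e x x y z = mix3 (a + b) c e x y z.
Proof.
move=> a0 b0 c0 e0 s1; rewrite /mix4.
rewrite (gamma_merge conv (Prob4 a0 b0 c0 e0 s1)) //.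
by congr gamma; apply: functional_extensionality => -[[|[|[|//]]] i].
Qed.

Lemma mix2_mix2 p q a b a' b' x y x' y' :
  0 <= p -> 0 <= q -> p + q = 1 -> 0 <= a -> 0 <= b -> a + b = 1 ->
  0 <= a' -> 0 <= b' -> a' + b' = 1 ->
  mix2 p q (mix2 a b x y) (mix2 a' b' x' y') =
  mix4 (p * a) (p * b) (q * a') (q * b') x y x' y'.
Proof.
move=> p0 q0 pq a0 b0 ab a0' b0' ab'.
have := gamma_assoc conv (vec x [:: x; y]) (vec x' [:: x'; y'])
  (Prob2 p0 q0 pq) (Prob2 a0 b0 ab) (Prob2 a0' b0' ab').
rewrite -/(mix2 a b x y) -/(mix2 a' b' x' y') => e.
transitivity (gamma (@vec R 2 0 [:: p; q])
  (fun k => if k == ord0 then mix2 a b x y else mix2 a' b' x' y')).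
  by congr gamma; apply: functional_extensionality => -[[|[|//]] i].
rewrite e; congr gamma; apply: functional_extensionality => i; rewrite /catI;
  case: splitP => -[[|[|//]] ?] /= ij; rewrite /vec ij //=.
Qed.

Lemma mix2_dist_l p q x x' y : 0 <= p -> 0 <= q -> p + q = 1 ->
  d (mix2 p q x y) (mix2 p q x' y) <= p * d x x'.
Proof.
move=> p0 q0 pq; apply: Rle_trans (gamma_lipschitz conv _ _ (Prob2 p0 q0 pq)) _.
by rewrite /sumR !big_ord_recl big_ord0 /vec /= (dist_refl metric_d); lra.
Qed.

Lemma mix2_dist_r p q x y y' : 0 <= p -> 0 <= q -> p + q = 1 ->
  d (mix2 p q x y) (mix2 p q x y') <= q * d y y'.
Proof.
move=> p0 q0 pq; apply: Rle_trans (gamma_lipschitz conv _ _ (Prob2 p0 q0 pq)) _.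
by rewrite /sumR !big_ord_recl big_ord0 /vec /= (dist_refl metric_d); lra.
Qed.

(** The weights [(1, 0, 0)] give [x] and are at distance [(1 - a) + b + c = 2 (1 - a)] from
    [(a, b, c)]. *)
Lemma mix3_first a b c x y z C :
  (forall mu nu (x : 'I_3 -> X), Prob mu -> Prob nu ->
     d (gamma mu x) (gamma nu x) <= C * l1dist mu nu) ->
  0 <= a -> 0 <= b -> 0 <= c -> a + b + c = 1 ->
  d x (mix3 a b c x y z) <= C * (2 * (1 - a)).
Proof.
move=> CP a0 b0 c0 s1.
have P1 : Prob (@vec R 3 0 [:: 1; 0; 0]) by apply: Prob3; lra.
rewrite -{1}[x]/(vec x [:: x; y; z] (ord0 : 'I_3)) -(gamma_vertex conv (i := ord0) _ P1) //.
apply: Rle_trans (CP _ _ _ P1 (Prob3 a0 b0 c0 s1)) _.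
rewrite /l1dist /sumR !big_ord_recl big_ord0 /vec /=.
rewrite (Rabs_pos_eq (1 - a)) ?(Rabs_minus_sym 0) ?Rminus_0_r ?(Rabs_pos_eq b)
  ?(Rabs_pos_eq c); try lra.
by apply: Req_le; congr (_ * _); lra.
Qed.

(** Both points are mixtures, with weights [p] and [p'], with the same second component
    [q x + q' y]; the first changes from [l x + m z] to [l y + m z], so weight [p l] passes from [x]
    to [y]. *)
Lemma mix_exchange l m p p' q q' x y z : 0 <= l -> 0 <= m -> l + m = 1 ->
  0 <= p -> 0 <= p' -> p + p' = 1 -> 0 <= q -> 0 <= q' -> q + q' = 1 ->
  d (mix3 (p * l + p' * q) (p * m) (p' * q') x z y)
    (mix3 (p' * q) (p * m) (p * l + p' * q') x z y)
  <= p * d (mix2 l m x z) (mix2 l m y z).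
Proof.
move=> l0 m0 lm p0 p0' pp q0 q0' qq.
have pl := Rmult_le_pos _ _ p0 l0; have pm := Rmult_le_pos _ _ p0 m0.
have pq := Rmult_le_pos _ _ p0' q0; have pq' := Rmult_le_pos _ _ p0' q0'.
have s : p * l + p * m + p' * q + p' * q' = 1.
  by rewrite -[RHS]pp -[in RHS](Rmult_1_r p) -[in RHS](Rmult_1_r p') -{1}lm -qq; ring.
have -> : mix3 (p * l + p' * q) (p * m) (p' * q') x z y =
          mix2 p p' (mix2 l m x z) (mix2 q q' x y).
  by rewrite mix2_mix2 // mix4_swap12 // mix4_merge //; lra.
have -> : mix3 (p' * q) (p * m) (p * l + p' * q') x z y =
          mix2 p p' (mix2 l m y z) (mix2 q q' x y).
  rewrite mix2_mix2 // mix4_swap13 // mix4_merge //; try lra.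
  by rewrite -mix3_rot //; lra.
exact: mix2_dist_l.
Qed.

(* Walk from (nearly) [x] to (nearly) [y] through the points with weights
   proportional to [(k - j) l, m, j l] on [x, z, y]; each step replaces a copy of
   [l x + m z] by one of [l y + m z]. *)
Lemma mix2_cancel l m x y z : 0 < l -> 0 <= m -> l + m = 1 ->
  l * d x y <= d (mix2 l m x z) (mix2 l m y z).
Proof.
move=> l0 m0 lm; set D := d (mix2 _ _ _ _) _.
have D0 : 0 <= D by exact: dist_ge0.
have [C [C0 CP]] := gamma_lipschitz_weights conv 3.
(* A bound on all multiples of [l * d x y - D] makes it nonpositive. *)
suff bound K : (0 < K)%nat -> INR K * (l * d x y - D) <= 4 * C + D.
  apply: Rnot_lt_le => lt; have pos : 0 < l * d x y - D by lra.
  have [K [K1 K2]] := archimed_cor1 _ (Rdiv_lt_0_compat _ (4 * C + D + 1) pos ltac:(lra)).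
  have /ltP/bound := K2; have /lt_0_INR Kp := K2.
  move: K1; rewrite /Rdiv => K1.
  have : INR K * (/ INR K) < INR K * ((l * d x y - D) * / (4 * C + D + 1)).
    exact: Rmult_lt_compat_l.
  rewrite Rinv_r; last lra.
  move=> h1 h2.
  have : INR K * ((l * d x y - D) * / (4 * C + D + 1)) * (4 * C + D + 1) =
         INR K * (l * d x y - D) by field; lra.
  nra.
move=> K0; set k := INR K; have k1 : 1 <= k by have /leP/le_INR := K0.
(* As [l + m = 1], this is [(k + 1) l + m], the total weight before normalisation; the walk has
   [k + 1] steps. *)
pose Z := k * l + 1; have Z0 : 0 < Z by rewrite /Z; nra.
have iZ := Rinv_0_lt_compat _ Z0; have ZZ : Z * / Z = 1 by apply: Rinv_r; lra.
pose u j := mix3 ((k + 1 - INR j) * l / Z) (m / Z) (INR j * l / Z) x z y.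
have step j : (j <= K)%nat -> d (u j) (u j.+1) <= / Z * D.
  move=> /leP/le_INR; rewrite -/k => jK; have j0 := pos_INR j.
  have kl : k * l * / Z + / Z = 1 by rewrite -ZZ /Z; ring.
  have kl0 : 0 <= k * l * / Z by apply: Rmult_le_pos; nra.
  have ik : 0 < / k by apply: Rinv_0_lt_compat; lra.
  (* With [p = 1 / Z] and [p' = k l / Z], this [q] gives [p l + p' q = (k + 1 - j) l / Z], the
     weight of [x] in [u j]. *)
  have q0 : 0 <= (k - INR j) / k by apply: Rle_mult_inv_pos; lra.
  have q0' : 0 <= INR j / k by apply: Rle_mult_inv_pos; lra.
  have qq : (k - INR j) / k + INR j / k = 1 by field; lra.
  have := mix_exchange x y z (Rlt_le _ _ l0) m0 lm (Rlt_le _ _ iZ) kl0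
    ltac:(lra) q0 q0' qq.
  rewrite -/D /u S_INR; congr (d (mix3 _ _ _ _ _ _) (mix3 _ _ _ _ _ _) <= _); field; lra.
have chain j : (j <= K.+1)%nat -> d (u 0%nat) (u j) <= INR j * (/ Z * D).
  elim: j => [|j IH] jK; first by rewrite (dist_refl metric_d) /=; lra.
  rewrite S_INR; have := dist_tri metric_d (u 0%nat) (u j) (u j.+1).
  by have := IH (ltnW jK); have := step j jK; lra.
have mZ : 0 <= m / Z by apply: Rle_mult_inv_pos.
have tot : (k + 1) * l / Z + m / Z = 1.
  have e : (k + 1) * l + m = Z by rewrite /Z; nra.
  by rewrite /Rdiv -Rmult_plus_distr_r e.
have w0 : 0 <= (k + 1) * l / Z by apply: Rle_mult_inv_pos => //; nra.
have mE : 1 - (k + 1) * l / Z = m / Z by lra.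
(* Each end of the walk has weight only [m / Z] off its target, an error that stays bounded after
   multiplication by [Z]. *)
have e0 : d x (u 0%nat) <= C * (2 * (m / Z)).
  rewrite -mE /u /= Rminus_0_r Rmult_0_l /Rdiv Rmult_0_l -/(m / Z) -/((k + 1) * l / Z).
  by apply: mix3_first => //; lra.
have e1 : d (u K.+1) y <= C * (2 * (m / Z)).
  rewrite (dist_sym metric_d) -mE /u S_INR -/k Rminus_diag /Rdiv !Rmult_0_l.
  rewrite -/(m / Z) -/((k + 1) * l / Z).
  have -> : mix3 0 (m / Z) ((k + 1) * l / Z) x z y = mix3 ((k + 1) * l / Z) 0 (m / Z) y x z.
    by symmetry; apply: mix3_rot; lra.
  by apply: mix3_first => //; lra.
have h := chain _ (leqnn K.+1); rewrite S_INR -/k in h.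
have t1 := dist_tri metric_d x (u 0%nat) y.
have t2 := dist_tri metric_d (u 0%nat) (u K.+1) y.
have le : d x y <= (4 * C * m + (k + 1) * D) * / Z.
  have -> : (4 * C * m + (k + 1) * D) * / Z =
    C * (2 * (m / Z)) + (k + 1) * (/ Z * D) + C * (2 * (m / Z)) by rewrite /Rdiv; ring.
  lra.
have := Rmult_le_compat_r _ _ _ (Rlt_le _ _ Z0) le.
rewrite Rmult_assoc (Rmult_comm (/ Z)) ZZ Rmult_1_r /Z.
have := dist_ge0 metric_d x y.
have : C * m <= C * 1 by apply: Rmult_le_compat_l; lra.
lra.
Qed.

End Mix.

(** * Separability *)

Lemma grid_approx t m : 0 <= t -> 0 < m -> exists a : nat, Rabs (t - INR a / m) <= / m.
Proof.
move=> t0 m0; have [h1 h2] := archimed (t * m).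
have tm : 0 <= t * m by nra.
have up0 : Z.le Z0 (up (t * m)) by apply: le_IZR; lra.
exists (Z.to_nat (up (t * m))); rewrite INR_IZR_INZ Znat.Z2Nat.id //.
have -> : t - IZR (up (t * m)) / m = - (IZR (up (t * m)) - t * m) * / m by field; lra.
have im := Rinv_0_lt_compat _ m0.
by rewrite Rabs_mult Rabs_Ropp (Rabs_pos_eq (/ m)) ?Rabs_pos_eq; nra.
Qed.

Section Separability.

Variables (X : Type) (d : X -> X -> R).
Hypothesis metric_d : is_metric d.

(** The cells may fail to be open, so the base consists of their open neighbourhoods of radius
    [1 / (l + 1)]. *)
Lemma second_countable_of_cells (T : countType) (S : T -> X -> Prop) :
  (forall y e, 0 < e -> exists c, S c y /\ forall y', S c y' -> d y y' < e) ->
  second_countable d.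
Proof.
move=> small.
exists (fun k p => if unpickle k is Some (c, l)
  then exists y, S c y /\ d y p < / INR (l : nat).+1 else False); split.
  move=> k p; case: (unpickle k : option (T * nat)) => [[c l]|//] [y [Sy yp]].
  exists (/ INR l.+1 - d y p); split=> [|q pq]; first lra.
  by exists y; split=> //; have := dist_tri metric_d y p q; lra.
move=> U x Uo Ux; have [r [r0 rU]] := Uo x Ux.
have r2 : 0 < r / 2 by lra.
have [c [Sx cS]] := small x _ r2.
have [l [lr /ltP l0]] := archimed_cor1 _ r2.
exists (pickle (c, l.-1)); rewrite pickleK prednK //; split.
  exists x; split=> //; rewrite (dist_refl metric_d).
  exact/Rinv_0_lt_compat/lt_0_INR/ltP.
move=> q [y [Sy yq]]; apply: rU.
by have := cS y Sy; have := dist_tri metric_d x y q; lra.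
Qed.

Variable gamma : gamma_type X.
Hypothesis conv : convex_like d gamma.

Definition adjoin n (y : X) (x : 'I_n -> X) : 'I_(1 + n) -> X := catI (fun _ : 'I_1 => y) x.

Lemma catI_eta T n m (f : 'I_(n + m) -> T) :
  f = catI (fun i => f (lshift m i)) (fun j => f (rshift n j)).
Proof.
apply: functional_extensionality => i; rewrite /catI.
by rewrite -[in LHS](splitK i); case: (split i).
Qed.

Lemma mix2_adjoin n l (nu : 'I_n -> R) y (x : 'I_n -> X) : 0 <= l <= 1 -> Prob nu ->
  mix2 gamma l (1 - l) y (gamma nu x) =
  gamma (catI (fun _ : 'I_1 => l) (fun j => (1 - l) * nu j)) (adjoin y x).
Proof.
move=> l01 Pn; have P1 : Prob (fun _ : 'I_1 => 1).
  by split=> [_|]; [lra | rewrite sumR_const /=; lra].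
have P2 : Prob (@vec R 2 0 [:: l; 1 - l]) by apply: Prob2; lra.
have := gamma_assoc conv (fun _ : 'I_1 => y) x P2 P1 Pn.
rewrite (gamma_vertex conv (i := ord0) (fun _ : 'I_1 => y) P1) // => e.
transitivity (gamma (@vec R 2 0 [:: l; 1 - l])
  (fun k : 'I_2 => if k == ord0 then y else gamma nu x)).
  by congr gamma; apply: functional_extensionality => -[[|[|//]] i].
rewrite e /vec /= Rmult_1_r //.
Qed.

(** One-point tuples are independent, since no weight vector vanishes at the only vertex, and tuples
    of [N + 2] points are not; hence some length is the last before independence fails. *)
Lemma max_independent N (p : X) : covering_dim_le d N ->
  exists n (x : 'I_n.+1 -> X), independent d gamma x /\
    forall x' : 'I_n.+2 -> X, ~ independent d gamma x'.
Proof.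
move=> dimN; apply: NNPP => no.
suff all_n n : exists x : 'I_n.+1 -> X, independent d gamma x.
  have [x ix] := all_n N.+1.
  exact: (covering_dim_not_independent metric_d conv dimN ix).
elim: n => [|n [x ix]].
  exists (fun _ => p) => q; exists ord0, 1; split; first lra.
  move=> mu [_]; rewrite /sumR big_ord_recl big_ord0 => /= s m0; lra.
apply: NNPP => no'; apply: no; exists n, x; split=> // x' ix'.
by apply: no'; exists x'.
Qed.

(** Dependence gives a [p] approached from every facet of [(y, x)]. The facet opposite to [y] yields
    [mu]. Let [p] keep distance [r] from the [i]-th facet of [x]: the facet opposite to [x i] yields
    [l y + (1 - l) q] with [q] in that [i]-th facet, so [l] cannot be small. *)
Lemma dependent_mix n (x : 'I_n -> X) y :
  independent d gamma x -> ~ independent d gamma (adjoin y x) ->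
  exists c, 0 < c /\ forall e, 0 < e -> exists l nu mu,
    [/\ c <= l <= 1, Prob nu, Prob mu &
        d (mix2 gamma l (1 - l) y (gamma nu x)) (gamma mu x) < e].
Proof.
move=> ix /not_all_ex_not[p dep].
have {}dep i r : 0 < r ->
    exists mu, [/\ Prob mu, mu i = 0 & d p (gamma mu (adjoin y x)) < r].
  move=> r0; apply: NNPP => no; apply: dep; exists i, r; split=> // mu Pm m0.
  by apply: Rnot_lt_le => lt; apply: no; exists mu.
have [i [r [r0 rP]]] := ix p.
have [C [C0 CP]] := gamma_lipschitz_weights conv 2.
(* From [r / 2 <= C (2 l)]; [C + 1] avoids a zero denominator. The minimum with 1 taken next serves
   the case [l = 1]. *)
have c0 : 0 < r / (4 * (C + 1)) by apply: Rdiv_lt_0_compat; lra.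
exists (Rmin 1 (r / (4 * (C + 1)))); split=> [|e e0]; first by apply: Rmin_glb_lt; lra.
have h0 : 0 < Rmin (e / 2) (r / 2) by apply: Rmin_glb_lt; lra.
have he := Rmin_l (e / 2) (r / 2); have hr := Rmin_r (e / 2) (r / 2).
have [mu [Pmu mu0 mup]] := dep (lshift n ord0) _ h0.
have [nu [Pnu nu0 nup]] := dep (rshift 1 i) _ h0.
have split_sum (f : 'I_(1 + n) -> R) :
    sumR f = f (lshift n ord0) + sumR (fun j => f (rshift 1 j)).
  rewrite {1}(catI_eta f) sumR_catI; congr (_ + _).
  by rewrite /sumR big_ord_recl big_ord0; lra.
pose mu' j := mu (rshift 1 j).
have Pmu' : Prob mu'.
  by case: Pmu => m0 m1; split=> [j|]; [exact: m0 | by rewrite split_sum mu0 Rplus_0_l in m1].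
have muE : gamma mu (adjoin y x) = gamma mu' x.
  have P2 : Prob (@vec R 2 0 [:: 0; 1 - 0]) by apply: Prob2; lra.
  transitivity (mix2 gamma 0 (1 - 0) y (gamma mu' x)).
    rewrite mix2_adjoin //; last lra.
    congr gamma; rewrite [LHS](catI_eta mu); congr catI; apply: functional_extensionality => j.
      by rewrite (ord1 j) mu0.
    by rewrite /mu'; lra.
  by rewrite /mix2 (gamma_vertex conv (i := ord_max) _ P2) // /vec /=; lra.
rewrite muE in mup.
set l := nu (lshift n ord0); have l0 : 0 <= l by apply: (proj1 Pnu).
pose tail j := nu (rshift 1 j); have tail0 : 0 <= sumR tail.
  by apply: sumR_ge0 => j; apply: (proj1 Pnu).
have ltail : l + sumR tail = 1 by rewrite -split_sum; apply: (proj2 Pnu).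
have [q [Pq [qE lc]]] : exists q, Prob q /\
    gamma nu (adjoin y x) = mix2 gamma l (1 - l) y (gamma q x) /\
    Rmin 1 (r / (4 * (C + 1))) <= l.
  (* For [l = 1] the remaining weights cannot be renormalised; any [q] will do, as its coefficient
     is 0. *)
  have [l1|l1] := Req_dec l 1.
    exists mu'; split=> //; split; last by rewrite l1; exact: Rmin_l.
    rewrite (gamma_vertex conv _ Pnu l1) /adjoin catI_lshift l1.
    have P2 : Prob (@vec R 2 0 [:: 1; 1 - 1]) by apply: Prob2; lra.
    by rewrite /mix2 (gamma_vertex conv (i := ord0) _ P2).
  have i0 : 0 < / (1 - l) by apply: Rinv_0_lt_compat; lra.
  pose q j := / (1 - l) * tail j.
  have Pq : Prob q.
    split=> [j|]; first by apply: Rmult_le_pos; [lra | apply: (proj1 Pnu)].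
    rewrite sumR_scal; have -> : sumR tail = 1 - l by lra.
    by apply: Rinv_l; lra.
  have qE : gamma nu (adjoin y x) = mix2 gamma l (1 - l) y (gamma q x).
    rewrite mix2_adjoin //; last lra.
    congr gamma; rewrite [LHS](catI_eta nu); congr catI; apply: functional_extensionality => j.
      by rewrite (ord1 j).
    by rewrite /q /tail; field; lra.
  exists q; split=> //; split=> //.
  have q0 : q i = 0 by rewrite /q /tail nu0; lra.
  have P2 : Prob (@vec R 2 0 [:: l; 1 - l]) by apply: Prob2; lra.
  have P2' : Prob (@vec R 2 0 [:: 0; 1]) by apply: Prob2; lra.
  have near : d (mix2 gamma l (1 - l) y (gamma q x)) (gamma q x) <= C * (2 * l).
    have {2}-> : gamma q x = mix2 gamma 0 1 y (gamma q x).
      by rewrite /mix2 (gamma_vertex conv (i := ord_max) _ P2').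
    apply: Rle_trans (CP _ _ _ P2 P2') _; apply: Req_le; congr (_ * _).
    rewrite /l1dist /sumR !big_ord_recl big_ord0 /vec /=.
    by split_Rabs; lra.
  have := rP q Pq q0; have := dist_tri metric_d p _ (gamma q x).
  move/(_ (mix2 gamma l (1 - l) y (gamma q x))); rewrite qE in nup.
  move=> h1 h2; apply: Rle_trans (Rmin_r _ _) _.
  have e1 : r / (4 * (C + 1)) * (4 * (C + 1)) = r by field; lra.
  apply: (Rmult_le_reg_r (4 * (C + 1))); first lra.
  rewrite e1; nra.
rewrite qE in nup; exists l, q, mu'; split=> //; first by split; lra.
have := dist_tri metric_d (mix2 gamma l (1 - l) y (gamma q x)) p (gamma mu' x).
by rewrite (dist_sym metric_d _ p); lra.
Qed.

(** * Countably many cells of small diameter *)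

Section Cells.

Variables (n : nat) (x : 'I_n -> X).

Definition mesh (M : nat) := / INR M.+1.

(** In the index, [c] bounds the weight of [y] from below, [M] is the precision, and [a], [u], [w]
    are the numerators of the rounded parameters; finite functions keep the index type countable. *)
Definition cell (k : nat * nat * nat * {ffun 'I_n -> nat} * {ffun 'I_n -> nat}) y :=
  let: (c, M, a, u, w) := k in
  exists l nu mu, [/\ mesh c <= l <= 1 /\ Rabs (l - INR a / INR M.+1) <= mesh M,
    Prob nu /\ forall i, Rabs (nu i - INR (u i) / INR M.+1) <= mesh M,
    Prob mu /\ forall i, Rabs (mu i - INR (w i) / INR M.+1) <= mesh M &
    d (mix2 gamma l (1 - l) y (gamma nu x)) (gamma mu x) < mesh M].

Lemma mesh_gt0 M : 0 < mesh M.
Proof. exact/Rinv_0_lt_compat/lt_0_INR/ltP. Qed.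

Lemma Rabs_close a b g h : Rabs (a - g) <= h -> Rabs (b - g) <= h -> Rabs (a - b) <= 2 * h.
Proof. by split_Rabs; lra. Qed.

Lemma cell_small : exists K, 0 <= K /\ forall c M a u w y y',
  cell (c, M, a, u, w) y -> cell (c, M, a, u, w) y' -> d y y' <= INR c.+1 * (K * mesh M).
Proof.
have [C1 [C10 CP1]] := gamma_lipschitz_weights conv n.
have [C2 [C20 CP2]] := gamma_lipschitz_weights conv 2.
have n0 := pos_INR n.
(* 2 for the errors in the two equations, [4 * C2] for replacing [l'] by [l], and [2 * (C1 * INR n)]
   for each change of weights, [nu'] to [nu] and [mu] to [mu']. Cancellation then divides by
   [l >= mesh c]. *)
exists (2 + 4 * C2 + 4 * (C1 * INR n)); split.
  by have := Rmult_le_pos _ _ C10 n0; lra.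
move=> c M a u w y y' [l [nu [mu [[l1 l2] [Pn nE] [Pm mE] near]]]].
move=> [l' [nu' [mu' [[l1' l2'] [Pn' nE'] [Pm' mE'] near']]]].
have h0 := mesh_gt0 M; have c0 := mesh_gt0 c.
have hull (al be : 'I_n -> R) (g : 'I_n -> R) : Prob al -> Prob be ->
    (forall i, Rabs (al i - g i) <= mesh M) -> (forall i, Rabs (be i - g i) <= mesh M) ->
    d (gamma al x) (gamma be x) <= 2 * (C1 * INR n) * mesh M.
  move=> Pa Pb ha hb; apply: Rle_trans (CP1 _ _ _ Pa Pb) _.
  have -> : 2 * (C1 * INR n) * mesh M = C1 * (INR n * (2 * mesh M)) by ring.
  apply: Rmult_le_compat_l => //; rewrite -sumR_const; apply: sumR_le => i.
  exact: Rabs_close (ha i) (hb i).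
have dq := hull _ _ _ Pn' Pn nE' nE; have dp := hull _ _ _ Pm Pm' mE mE'.
have P2 : Prob (@vec R 2 0 [:: l; 1 - l]) by apply: Prob2; lra.
have P2' : Prob (@vec R 2 0 [:: l'; 1 - l']) by apply: Prob2; lra.
have dl : d (mix2 gamma l' (1 - l') y' (gamma nu' x)) (mix2 gamma l (1 - l) y' (gamma nu' x))
    <= C2 * (4 * mesh M).
  apply: Rle_trans (CP2 _ _ _ P2' P2) _; apply: Rmult_le_compat_l => //.
  rewrite /l1dist /sumR !big_ord_recl big_ord0 /vec /=.
  have -> : 1 - l' - (1 - l) = - (l' - l) by ring.
  by rewrite Rabs_Ropp; have := Rabs_close l2' l2; lra.
have dr : d (mix2 gamma l (1 - l) y' (gamma nu' x)) (mix2 gamma l (1 - l) y' (gamma nu x))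
    <= d (gamma nu' x) (gamma nu x).
  apply: Rle_trans (mix2_dist_r metric_d conv _ _ _ _ _ _) _; try lra.
  by have := dist_ge0 metric_d (gamma nu' x) (gamma nu x); nra.
have key : l * d y y' <= d (mix2 gamma l (1 - l) y (gamma nu x)) (mix2 gamma l (1 - l) y' (gamma nu x)).
  by apply: (mix2_cancel metric_d conv); lra.
have t1 := dist_tri metric_d (mix2 gamma l (1 - l) y (gamma nu x)) (gamma mu x)
  (mix2 gamma l (1 - l) y' (gamma nu x)).
have t2 := dist_tri metric_d (gamma mu x) (gamma mu' x) (mix2 gamma l (1 - l) y' (gamma nu x)).
have t3 := dist_tri metric_d (gamma mu' x) (mix2 gamma l' (1 - l') y' (gamma nu' x))
  (mix2 gamma l (1 - l) y' (gamma nu x)).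
have t4 := dist_tri metric_d (mix2 gamma l' (1 - l') y' (gamma nu' x))
  (mix2 gamma l (1 - l) y' (gamma nu' x)) (mix2 gamma l (1 - l) y' (gamma nu x)).
rewrite (dist_sym metric_d) in near'.
have le : mesh c * d y y' <= (2 + 4 * C2 + 4 * (C1 * INR n)) * mesh M.
  have := Rmult_le_compat_r _ _ _ (dist_ge0 metric_d y y') (proj1 l1); lra.
have cc : INR c.+1 * mesh c = 1 by apply: Rinv_r; apply/not_0_INR.
have := Rmult_le_compat_l _ _ _ (pos_INR c.+1) le.
by rewrite -Rmult_assoc cc Rmult_1_l.
Qed.

Lemma cell_cover c M y l nu mu : mesh c <= l <= 1 -> Prob nu -> Prob mu ->
  d (mix2 gamma l (1 - l) y (gamma nu x)) (gamma mu x) < mesh M ->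
  exists a u w, cell (c, M, a, u, w) y.
Proof.
move=> l1 Pn Pm near; have M0 : 0 < INR M.+1 by exact/lt_0_INR/ltP.
have l0 : 0 <= l by have := mesh_gt0 c; lra.
have [a aP] := grid_approx l0 M0.
have [u uP] := fin_all_exists (fun i => grid_approx (proj1 Pn i) M0).
have [w wP] := fin_all_exists (fun i => grid_approx (proj1 Pm i) M0).
exists a, (finfun u), (finfun w), l, nu, mu.
by split=> //; split=> // i; rewrite ffunE.
Qed.

End Cells.

End Separability.

Theorem theorem2p9 (X : Type) (d : X -> X -> R) (gamma : gamma_type X) :
  is_metric d -> bounded_metric d -> complete_metric d ->
  convex_like d gamma -> finite_covering_dim d ->
  second_countable d.
Proof.
move=> metric_d _ _ conv [N dimN].
(* [max_independent] starts from a point; the empty space is covered by no cells at all. *)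
case: (classic (exists p : X, True)) => [[p _]|empty]; last first.
  apply: (@second_countable_of_cells _ _ metric_d nat (fun _ _ => False)) => y.
  by case: empty; exists y.
have [n [x [ix max_x]]] := max_independent metric_d conv p dimN.
have [K [K0 small]] := cell_small metric_d conv x.
apply: (second_countable_of_cells metric_d (S := cell d gamma x)) => y e e0.
have [c [c0 cP]] := dependent_mix metric_d conv ix (max_x (adjoin y x)).
have [k [kc /ltP k0]] := archimed_cor1 _ c0.
have kpos : 0 < INR k by exact/lt_0_INR/ltP.
have bound0 : 0 < e / (INR k * (K + 1)) by apply: Rdiv_lt_0_compat => //; nra.
(* This precision brings the diameter bound [k K / m] below [e]; [k.-1] and [m.-1] undo the
   successor in [mesh]. *)
have [m [me /ltP m0]] := archimed_cor1 _ bound0.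
have mE : mesh m.-1 = / INR m by rewrite /mesh prednK.
have kE : mesh k.-1 = / INR k by rewrite /mesh prednK.
have [l [nu [mu [lc Pn Pm near]]]] := cP _ (mesh_gt0 m.-1).
have lk : mesh k.-1 <= l <= 1 by rewrite kE; lra.
have [a [u [w yc]]] := cell_cover lk Pn Pm near.
exists (k.-1, m.-1, a, u, w); split=> // y' yc'.
apply: Rle_lt_trans (small _ _ _ _ _ _ _ yc yc') _.
rewrite prednK // mE.
have := Rmult_lt_compat_l (INR k * (K + 1)) _ _ ltac:(nra) me.
have -> : INR k * (K + 1) * (e / (INR k * (K + 1))) = e by field; nra.
have := Rinv_0_lt_compat _ (lt_0_INR _ (elimT ltP m0)); nra.
Qed.
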